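(* Let $T$ be fixed, let $I$ be a finite nonempty index set, let $\Phi^k$, $k\in I$, be continuously differentiable real-valued functions of $(x,t)\in\mathbb{R}^n\times\mathbb{R}$, and let $(x^*,u^* )$ be an optimal pair for the optimal control problem described in the context with terminal constraints $\Phi^k(x(T),T)\le 0$, $k\in I$, such that $\Phi^k(x^*(T),T)=0$ for all $k\in I$. Let $\phi_{\mathrm{term}}(x)=\max_{k\in I}\Phi^k(x(T),T)$. Then the following conditions are equivalent: (i) (Mangasarian–Fromovitz constraint qualification at $x^*$) there exists a vector $d\in\mathbb{R}^n$ such that $\langle\nabla\Phi^k(x^*(T),T),d\rangle<0$ for all $k\in I$; (ii) $0\notin\partial\phi_{\mathrm{term}}(x^* )$.
   Context: Setting: minimize $\Phi^0(x(T),T)$, with $\Phi^0$ continuously differentiable, over piecewise continuous controls $u$ with values in a compact set $V\subset\mathbb{R}^m$ and piecewise continuously differentiable states $x:[t_0,T]\to\mathbb{R}^n$ subject to $\dot x(t)=f(x(t),u(t),t)$, $x(t_0)=x_0$, and the terminal constraints. The map $f$ is differentiable in $x$, Lipschitz in $x$ uniformly in $(u,t)$, and $f$ and $\partial f/\partial x$ are continuous. Gradients $\nabla\Phi^k$ are with respect to the spatial variable $x\in\mathbb{R}^n$. The subdifferential $\partial\phi_{\mathrm{term}}(x)$ is that of a maximum of finitely many smooth functions of the endpoint $x(T)$, i.e. the convex hull in $\mathbb{R}^n$ of the gradients $\nabla\Phi^k(x(T),T)$ over those $k\in I$ with $\Phi^k(x(T),T)=\phi_{\mathrm{term}}(x)$.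 *)

(* Defs.v *)
From HB Require Import structures.
From mathcomp Require Import all_boot all_order all_algebra.
From mathcomp Require Import all_classical all_reals all_analysis.

Set Implicit Arguments.
Unset Strict Implicit.
Unset Printing Implicit Defensive.

Import Order.TTheory GRing.Theory Num.Theory.
Import numFieldNormedType.Exports.

Local Open Scope classical_set_scope.
Local Open Scope ring_scope.

(* Vectors of R^n are row vectors 'rV[R]_n. Their library norm is the sup norm;
   compactness, continuity, differentiability and Lipschitz continuity do not
   depend on this choice. *)

Section VectorCalculus.
Context {R : realType}.

Definition inner n (v w : 'rV[R]_n) : R := \sum_(i < n) v 0 i * w 0 i.

Definition grad n (g : 'rV[R]_n -> R) (x : 'rV[R]_n) : 'rV[R]_n :=
  \row_(i < n) 'D_(delta_mx 0 i) g x.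

(* Used on finite-dimensional E only, where continuity of x |-> 'd g x for the
   operator norm amounts to continuity of x |-> 'd g x v for each v. *)
Definition continuously_differentiable (E : normedModType R) (g : E -> R) :=
  (forall x, differentiable g x) /\ (forall v, continuous (fun x => 'd g x v)).

Definition convex_hull n (A : set 'rV[R]_n) : set 'rV[R]_n :=
  smallest (fun C : set 'rV[R]_n => convex_set C) A.

End VectorCalculus.

Section PiecewiseFunctions.
Context {R : realType}.

(* A partition a = s_0 < s_1 < ... < s_N = b is encoded by s = [:: s_1; ...; s_N].
   The values of a function at the s_i are left unconstrained by conditions on
   the open pieces ]s_i, s_(i+1)[. *)
Definition on_pieces (a b : R) (P : R -> R -> Prop) (s : seq R) :=
  itv_partition a b s /\
  forall i, (i < size s)%N -> P (nth b (a :: s) i) (nth b (a :: s) i.+1).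

Definition continuous_with_end_limits n (g : R -> 'rV[R]_n) (c d : R) :=
  [/\ {in `]c, d[, continuous g}, cvg (g @ c^'+) & cvg (g @ d^'-)].

Definition piecewise_continuous n (a b : R) (g : R -> 'rV[R]_n) :=
  exists s, on_pieces a b (continuous_with_end_limits g) s.

Definition piecewise_C1 n (a b : R) (g : R -> 'rV[R]_n) :=
  {within `[a, b], continuous g} /\
  exists s, on_pieces a b (fun c d =>
    {in `]c, d[, forall t, derivable g t 1} /\
    continuous_with_end_limits (derive1 g) c d) s.

End PiecewiseFunctions.

Section ControlProblem.
Context {R : realType} {n m : nat} {I : finType}.
Implicit Types (T : R) (V : set 'rV[R]_m).
Implicit Types (f : 'rV[R]_n -> 'rV[R]_m -> R -> 'rV[R]_n).
Implicit Types (Phi : I -> 'rV[R]_n * R -> R).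
Implicit Types (x : R -> 'rV[R]_n) (u : R -> 'rV[R]_m).

Definition regular_dynamics (t0 : R) T V f :=
  let D : set ('rV[R]_n * 'rV[R]_m * R) := setT `*` V `*` `[t0, T] in
  [/\ forall y v t, V v -> t \in `[t0, T] ->
        differentiable (fun z => f z v t) y,
      exists L : R, forall v t, V v -> t \in `[t0, T] ->
        L.-lipschitz (fun z => f z v t),
      {within D, continuous (fun p => f p.1.1 p.1.2 p.2)} &
      {within D, continuous (fun p => 'J (fun z => f z p.1.2 p.2) p.1.1)}].

(* States and controls are functions on R of which only the restriction to
   [t0, T] matters. The state equation is imposed outside a finite set of
   times (switching times of u, corners of x). *)
Definition admissible (t0 : R) T (x0 : 'rV[R]_n) V f Phi x u :=
  [/\ piecewise_C1 t0 T x,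
      piecewise_continuous t0 T u /\ (forall t, t \in `[t0, T] -> V (u t)),
      exists s : seq R, forall t, t \in `]t0, T[ -> t \notin s ->
        is_derive t 1 x (f (x t) (u t) t),
      x t0 = x0 &
      forall k, Phi k (x T, T) <= 0].

Definition optimal_pair (t0 : R) T (x0 : 'rV[R]_n) V f
    (Phi0 : 'rV[R]_n * R -> R) Phi x u :=
  admissible t0 T x0 V f Phi x u /\
  forall y w, admissible t0 T x0 V f Phi y w ->
    Phi0 (x T, T) <= Phi0 (y T, T).

Definition spatial_grad Phi k (t : R) (y : 'rV[R]_n) : 'rV[R]_n :=
  grad (fun z => Phi k (z, t)) y.

(* The index k0 witnesses that I is nonempty; the maximum does not depend on
   it. *)
Definition phi_term (k0 : I) T Phi x : R :=
  \big[Num.max/Phi k0 (x T, T)]_(k : I) Phi k (x T, T).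

Definition subdiff_phi_term (k0 : I) T Phi x : set 'rV[R]_n :=
  convex_hull [set spatial_grad Phi k T (x T) |
    k in [set k | Phi k (x T, T) = phi_term k0 T Phi x]].

Definition MFCQ T Phi x :=
  exists d : 'rV[R]_n, forall k, inner (spatial_grad Phi k T (x T)) d < 0.

End ControlProblem.

(* Main.v *)
Require Import Defs.
From HB Require Import structures.
From mathcomp Require Import all_boot all_order all_algebra.
From mathcomp Require Import all_classical all_reals all_analysis.
From mathcomp Require Import ring lra.

Import Order.TTheory GRing.Theory Num.Theory.
Import numFieldNormedType.Exports.

Local Open Scope classical_set_scope.
Local Open Scope ring_scope.

(** All constraints are active, so the maximum is [0] and is attained by every
    index: the subdifferential is the convex hull of all the gradients. The
    theorem is then Gordan's alternative for a finite family of vectors. The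
    nontrivial half goes by induction on the family. Given a direction [d] that
    is good for [s] and a new vector [v] with [inner v d > 0], replace each [w]
    of [s] by the point of the segment from [w] to [v] orthogonal to [d]; a
    direction good for these points is corrected by a multiple of [d] to become
    orthogonal to [v], and a final push along [- v] makes all inequalities
    strict. *)

Section Inner.
Context {R : realType} {n : nat}.
Implicit Types (u v w : 'rV[R]_n) (a b : R).

Lemma innerC v w : inner v w = inner w v.
Proof. by apply: eq_bigr => i _; rewrite mulrC. Qed.

Lemma inner_lin_l a b u v w :
  inner (a *: u + b *: v) w = a * inner u w + b * inner v w.
Proof.
rewrite /inner !mulr_sumr -big_split; apply: eq_bigr => i _.
by rewrite !mxE/=; ring.
Qed.

Lemma inner_lin_r a b u v w :
  inner w (a *: u + b *: v) = a * inner w u + b * inner w v.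
Proof. by rewrite innerC inner_lin_l !(innerC w). Qed.

Lemma inner0l w : inner 0 w = 0.
Proof. by rewrite /inner big1// => i _; rewrite mxE mul0r. Qed.

Lemma inner_gt0 v : v != 0 -> 0 < inner v v.
Proof.
have vv_ge0 i : 0 <= v 0 i * v 0 i by rewrite -expr2 sqr_ge0.
move=> v_neq0; rewrite lt_def sumr_ge0// andbT.
apply: contra v_neq0 => /eqP /(psumr_eq0P (fun i _ => vv_ge0 i)) v_eq0.
apply/eqP/rowP => i; rewrite mxE; apply/eqP.
by have /eqP := v_eq0 i isT; rewrite mulf_eq0 orbb.
Qed.

End Inner.

Section Gordan.
Context {R : realType}.

Lemma convex_set_segment {n} (C : set 'rV[R]_n) (u v : 'rV[R]_n) (a : R) :
  convex_set C -> C u -> C v -> 0 <= a <= 1 -> C (a *: u + (1 - a) *: v).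
Proof.
move=> convC Cu Cv /andP[a_ge0 a_le1].
have := convC u v (Itv01 a_ge0 a_le1) (mem_set Cu) (mem_set Cv).
by rewrite inE.
Qed.

Lemma convex_set_halfspace {n} (d : 'rV[R]_n) :
  convex_set [set v : 'rV[R]_n | inner v d < 0].
Proof.
apply/convex_setW => u v /set_mem/= ud /set_mem/= vd k k_gt0 k_lt1.
apply/mem_set.
suff: inner (k%:num *: (u : 'rV[R]_n) + (1 - k%:num) *: (v : 'rV[R]_n)) d < 0.
  by [].
rewrite inner_lin_l; nra.
Qed.

(** Any [K >= q x] works for a given [x]; the sum of these nonnegative thresholds over [s] is at
    least each of them. *)
Lemma strict_dominance (E : eqType) (s : seq E) (A B : E -> R) :
  {in s, forall x, A x < 0} ->
  exists2 K, 0 <= K & {in s, forall x, K * A x + B x < 0}.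
Proof.
move=> A_lt0; pose q x := (`|B x| + 1) / - A x.
have q_ge0 x : x \in s -> 0 <= q x.
  by move=> xs; rewrite divr_ge0 ?addr_ge0// oppr_ge0 ltW ?A_lt0.
(* The guard [y \in s] keeps the sum nonnegative over any [r], in particular over [s] with [x]
   removed. *)
have K_ge0 (r : seq E) : 0 <= \sum_(y <- r) if y \in s then q y else 0.
  by apply: sumr_ge0 => y _; case: ifP => // /q_ge0.
exists (\sum_(y <- s) if y \in s then q y else 0) => // x xs.
have Ax := A_lt0 x xs.
have qx : q x <= \sum_(y <- s) if y \in s then q y else 0.
  by rewrite (big_rem x)//= xs lerDl.
have qA : q x * A x = - (`|B x| + 1) by rewrite /q; field; lra.
have := ler_norm (B x); nra.
Qed.

(** Quantifying over convex [C] expresses that [0] lies in the hull without convex coefficients: a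
    [C] containing [v :: s] also contains the segment points used in the induction. *)
Lemma gordan n (s : seq 'rV[R]_n) :
  (exists d, {in s, forall v, inner v d < 0}) \/
  (forall C : set 'rV[R]_n, convex_set C -> {in s, forall v, C v} -> C 0).
Proof.
move sE : (size s) => N; elim: N s sE => [s /size0nil->|N IHN [//|v s] [sN]].
  by left; exists 0.
have [v_eq0|v_neq0] := eqVneq v 0.
  by right => C _ /(_ v (mem_head _ _)); rewrite v_eq0.
(* A weak inequality at [v] suffices: [K *: e - v] has the extra term [- inner v v < 0] at [v], and
   a large [K] keeps it negative on [s]. *)
suff [[e ve se]|hull0] :
    (exists2 e, inner v e <= 0 & {in s, forall w, inner w e < 0}) \/
    (forall C : set 'rV[R]_n, convex_set C ->
      {in v :: s, forall w, C w} -> C 0).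
- have [K K_ge0 Ks] := strict_dominance _ _ _ (fun w => - inner w v) se.
  left; exists (K *: e + (-1) *: v) => w.
  rewrite inE inner_lin_r => /predU1P[->|ws].
    by have := inner_gt0 _ v_neq0; nra.
  by have := Ks w ws; lra.
- by right.
have [[d d_neg]|hull0] := IHN s sN; last first.
  right => C convC Cs; apply: hull0 => // w ws; apply: Cs.
  by rewrite inE ws orbT.
have [vd_lt0|vd_ge0] := ltP (inner v d) 0.
  by left; exists d => //; rewrite ltW.
pose c := inner v d.
(* Solution of [t * inner w d + (1 - t) * c = 0]; it lies in [0, 1] because [inner w d < 0 <= c]. *)
pose t w := c / (c - inner w d).
have tP w : w \in s -> 0 <= t w <= 1.
  move=> /d_neg wd; have cw : 0 < c - inner w d by rewrite /c; lra.
  by rewrite /t divr_ge0 ?(ltW cw)//= ler_pdivrMr// mul1r; lra.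
have [[d' d'_neg]|hull0] :=
    IHN [seq t w *: w + (1 - t w) *: v | w <- s] (etrans (size_map _ _) sN);
  last first.
  right => C convC Cvs; apply: hull0 => // _ /mapP[w ws ->].
  apply: convex_set_segment; rewrite ?tP//; apply: Cvs; last exact: mem_head.
  by rewrite inE ws orbT.
(* If [c = 0], every segment point collapses to [v], but [d] itself already serves as [e]. *)
left; have [c_eq0|c_neq0] := eqVneq c 0.
  by exists d => //; rewrite -/c c_eq0.
have c_gt0 : 0 < c by rewrite lt_def c_neq0.
exists (1 *: d' + (- (inner v d' / c)) *: d) => [|w ws].
  by rewrite inner_lin_r -/c mulNr divfK// mul1r subrr.
have wd := d_neg w ws; have cw : 0 < c - inner w d by lra.
have := d'_neg _ (map_f _ ws); rewrite inner_lin_l inner_lin_r.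
(* The segment point is orthogonal to [d], so pairing it with [d'] or with the corrected direction
   gives the same value; the latter is orthogonal to [v], so only the [w] term remains. *)
have -> : t w * inner w d' + (1 - t w) * inner v d' =
    t w * (1 * inner w d' + - (inner v d' / c) * inner w d).
  by rewrite /t; field; rewrite c_neq0 (gt_eqF cw).
by rewrite pmulr_rlt0// divr_gt0.
Qed.

End Gordan.

Theorem theorem4 (R : realType) (n m : nat) (I : finType) (k0 : I)
    (t0 T : R) (x0 : 'rV[R]_n) (V : set 'rV[R]_m)
    (f : 'rV[R]_n -> 'rV[R]_m -> R -> 'rV[R]_n)
    (Phi0 : 'rV[R]_n * R -> R) (Phi : I -> 'rV[R]_n * R -> R)
    (xs : R -> 'rV[R]_n) (us : R -> 'rV[R]_m)
    (t0_lt_T : t0 < T)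
    (V_compact : compact V)
    (f_regular : regular_dynamics t0 T V f)
    (Phi0_C1 : continuously_differentiable Phi0)
    (Phi_C1 : forall k, continuously_differentiable (Phi k))
    (xs_us_optimal : optimal_pair t0 T x0 V f Phi0 Phi xs us)
    (Phi_active : forall k, Phi k (xs T, T) = 0) :
  MFCQ T Phi xs <-> ~ subdiff_phi_term k0 T Phi xs 0.
Proof.
have phi0 : phi_term k0 T Phi xs = 0.
  rewrite /phi_term; apply: (big_ind (fun r => r = 0)) => //.
  by move=> a b -> ->; rewrite maxxx.
have hullE : subdiff_phi_term k0 T Phi xs =
    convex_hull [set spatial_grad Phi k T (xs T) | k in [set: I]].
  rewrite /subdiff_phi_term phi0; congr (convex_hull (_ @` _)).
  by apply/seteqP; split=> k _ /=; rewrite ?Phi_active.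
rewrite hullE; split=> [[d d_neg]|hull0].
  have sub : [set spatial_grad Phi k T (xs T) | k in [set: I]] `<=`
      [set v | inner v d < 0] by move=> _ [k _ <-]; exact: d_neg.
  move=> /(smallest_sub (convex_set_halfspace d) sub)/=.
  by rewrite inner0l ltxx.
have [[d d_neg]|in_hull] :=
  gordan n [seq spatial_grad Phi k T (xs T) | k <- enum I].
  by exists d => k; apply: d_neg; apply/mapP; exists k; rewrite ?mem_enum.
(* The hull is the intersection of all convex sets containing the gradients, so it is enough to find
   [0] in each of them. *)
case: hull0 => C [convC subC]; apply: in_hull => // _ /mapP[k _ ->].
by apply: subC; exists k.
Qed.
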